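(* Let $\kappa\leq\lambda<\mu$ be infinite cardinals. If $\mathsf{KH}(\kappa,\lambda)$ fails and $\mathsf{KH}(\kappa,\mu)$ holds, then $\mathsf{KH}(\lambda^+,\mu)$ holds. In symbols, $\lnot\mathsf{KH}(\kappa,\lambda)\land\mathsf{KH}(\kappa,\mu)\rightarrow\mathsf{KH}(\lambda^+,\mu)$.
   Context: The background theory is $\mathsf{ZFC}$. For cardinals $\kappa\leq\lambda$, $\mathcal{P}_\kappa(\lambda)=\{x\subseteq\lambda:|x|<\kappa\}$. For a family $\mathcal{F}$ of sets of ordinals and a set $x$, $\mathcal{F}\upharpoonright x=\{A\cap x:A\in\mathcal{F}\}$. A slim $(\kappa,\lambda)$-family is a collection $\mathcal{F}\subseteq\mathcal{P}(\lambda)$ such that $|\mathcal{F}\upharpoonright x|<\kappa$ for every $x\in\mathcal{P}_\kappa(\lambda)$. $\mathsf{KH}(\kappa,\lambda,\nu)$ is the statement that there exists a slim $(\kappa,\lambda)$-family of cardinality $\nu$, and $\mathsf{KH}(\kappa,\lambda)$ is $\mathsf{KH}(\kappa,\lambda,\lambda^+)$. Here these definitions are read for all infinite cardinals $\kappa\leq\lambda$. *)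

(* Defs.v *)
From mathcomp Require Import all_boot.
From mathcomp Require Import boolp classical_sets functions cardinality.

Set Implicit Arguments.
Unset Strict Implicit.
Unset Printing Implicit Defensive.

Local Open Scope classical_set_scope.
Local Open Scope card_scope.

(* A cardinal is represented by any set having that cardinality; cardinals are
   compared through [#<=] and [#=], so every notion below depends only on the
   cardinalities of its arguments. *)

Definition card_lt T U (A : set T) (B : set U) : Prop :=
  A #<= B /\ ~ (B #<= A).
Notation "A '#<' B" := (card_lt A B) (at level 79) : card_scope.

Definition is_succ_card T U (A : set T) (S : set U) : Prop :=
  A #< S /\ forall (V : Type) (C : set V), A #< C -> S #<= C.

(* Zorn's lemma on sets of choice functions with injective evaluations. *)
Lemma least_card (I T : Type) (F : I -> set T) (i0 : I) :
  exists i, forall j, F i #<= F j.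
Proof.
pose P := [set Y : set (I -> T) | (forall f, Y f -> forall i, F i (f i)) /\
  (forall f g i, Y f -> Y g -> f i = g i -> f = g)].
have [Y [[YF Yinj] Ymax]] : exists A, P A /\ (forall B, A `<` B -> ~ P B).
  apply: Zorn_bigcup => G GP Gtot; split.
    by move=> f [Y GY Yf] i; have [+ _] := GP _ GY; exact.
  move=> f g i [Y GY Yf] [Z GZ Zg] fg.
  have [YZ|ZY] := Gtot _ _ GY GZ.
    by have [_ inj] := GP _ GZ; apply: (inj _ _ i) => //; exact: YZ.
  by have [_ inj] := GP _ GY; apply: (inj _ _ i) => //; exact: ZY.
have [i Hi] : exists i, F i `<=` (fun f => f i) @` Y.
  apply: contrapT => nsurj.
  have /choice[f fP] : forall i, exists t, F i t /\ ~ ((fun g => g i) @` Y) t.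
    move=> i; apply: contrapT => h; apply: nsurj; exists i => t Fit.
    by apply: contrapT => nt; apply: h; exists t.
  have nYf : ~ Y f by move=> Yf; apply: (fP i0).2; exists f.
  apply: (Ymax (Y `|` [set f])).
    split; first by move=> g; left.
    by move=> h; apply: nYf; apply: h; right.
  split.
    by move=> g [/YF//|->] j; exact: (fP j).1.
  move=> g h j [Yg|->] [Yh|->] //; first exact: Yinj.
  - by move=> e; case: (fP j).2; exists g.
  - by move=> e; case: (fP j).2; exists h.
exists i => j.
apply: (card_le_trans (subset_card_le Hi)).
apply: (card_le_trans (card_image_le _ _)).
have /card_eqPle[_ YE] : (fun f => f j) @` Y #= Y.
  by apply: inj_card_eq => f g /set_mem Yf /set_mem Yg; exact: Yinj.
apply: (card_le_trans YE); apply: subset_card_le => _ [f Yf <-].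
exact: YF.
Qed.

Lemma card_le_total T U (A : set T) (B : set U) : A #<= B \/ B #<= A.
Proof.
have eA : @inl T U @` A #= A by apply: inj_card_eq => x y _ _ [].
have eB : @inr T U @` B #= B by apply: inj_card_eq => x y _ _ [].
have [b] := @least_card bool (T + U)
  (fun b => if b then inl @` A else inr @` B) true.
case: b => [/(_ false)|/(_ true)] h; [left|right].
  by rewrite -(card_le_eql eA) -(card_le_eqr eB).
by rewrite -(card_le_eql eB) -(card_le_eqr eA).
Qed.

Lemma card_lt_powerset T (A : set T) : A #< [set B | B `<=` A].
Proof.
split.
  have /card_eqPle[_ h] : set1 @` A #= A.
    by apply: inj_card_eq => x y _ _ xy; have : [set x] x by []; rewrite xy.
  apply: (card_le_trans h); apply: subset_card_le => _ [x Ax <-] y ->.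
  exact: Ax.
elim/Ppointed: T => T in A *.
  rewrite card_le_emptyr => /eqP P0.
  by have : [set B | B `<=` A] set0 by []; rewrite P0.
move=> /pcard_leP[f].
pose D := [set y | exists B, [/\ B `<=` A, f B = y & ~ B y]].
have DA : D `<=` A by move=> _ [B [BA <- _]]; exact: (@funS _ _ _ _ f).
have nD : ~ D (f D).
  move=> DD; have [B [BA fB nB]] := DD.
  have BD : B = D by apply: (@inj _ _ _ f) => //; exact: mem_set.
  by apply: nB; rewrite BD.
by apply: (nD); exists D.
Qed.

Lemma succ_card_exists T (A : set T) :
  exists S : set (set T), is_succ_card A S.
Proof.
pose P := [set B | B `<=` A].
pose I := {B : set (set T) | B `<=` P /\ A #< B}.
have PP : P `<=` P /\ A #< P by split => //; exact: card_lt_powerset.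
have [[S [SP AS]] /= Smin] := least_card (fun B : I => sval B) (exist _ P PP).
exists S; split => // V C AC.
have [PC|CP] := card_le_total P C.
  exact: card_le_trans (subset_card_le SP) PC.
have /pcard_leP[f] := CP.
have fC : f @` C #= C by exact: card_image.
have fP : f @` C `<=` P /\ A #< f @` C.
  split; first by move=> _ [c Cc <-]; exact: (@funS _ _ _ _ f).
  by split; rewrite ?(card_le_eqr fC) ?(card_le_eql fC); case: AC.
by have := Smin (exist _ _ fP); rewrite /= (card_le_eqr fC).
Qed.

(* The successor cardinal; its carrier is an arbitrary choice, only its
   cardinality matters. *)
Definition succ_card T (A : set T) : set (set T) :=
  sval (cid (succ_card_exists A)).

Lemma succ_cardP T (A : set T) : is_succ_card A (succ_card A).
Proof. exact: svalP (cid (succ_card_exists A)). Qed.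

Definition Pkappa T U (kappa : set T) (lambda : set U) : set (set U) :=
  [set x | x `<=` lambda /\ x #< kappa].

Definition family_restr U (F : set (set U)) (x : set U) : set (set U) :=
  [set A `&` x | A in F].

Definition slim_family T U (kappa : set T) (lambda : set U)
    (F : set (set U)) : Prop :=
  (forall A, F A -> A `<=` lambda) /\
  forall x, Pkappa kappa lambda x -> family_restr F x #< kappa.

Definition KH3 T U V (kappa : set T) (lambda : set U) (nu : set V) : Prop :=
  exists F : set (set U), slim_family kappa lambda F /\ F #= nu.

Definition KH T U (kappa : set T) (lambda : set U) : Prop :=
  KH3 kappa lambda (succ_card lambda).

(* Main.v *)
Require Import Defs.
From mathcomp Require Import all_boot.
From mathcomp Require Import boolp classical_sets functions cardinality.

Set Implicit Arguments.
Unset Strict Implicit.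
Unset Printing Implicit Defensive.

Local Open Scope classical_set_scope.
Local Open Scope card_scope.

(** The family [F] that witnesses [KH kappa mu] already witnesses
    [KH (succ_card lambda) mu].  If it did not, some [x `<=` mu] of cardinality
    at most [lambda] would carry more than [lambda] traces [A `&` x] with
    [F A].  Slimness for [kappa] only concerns the traces on sets smaller than
    [kappa], so it passes to the family of traces on [x], to its subfamilies,
    and, along an injection of [x] into [lambda], to families of subsets of
    [lambda].  A subfamily of cardinality [lambda^+] would thus give
    [KH kappa lambda] ([KH3_of_trace]). *)

Lemma card_ltNge (T U : Type) (A : set T) (B : set U) :
  A #< B <-> ~ (B #<= A).
Proof.
split=> [[]//|nBA]; split=> //.
by have [|/nBA] := card_le_total A B.
Qed.

Lemma card_le_lt_trans (T U V : Type) (A : set T) (B : set U) (C : set V) :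
  A #<= B -> B #< C -> A #< C.
Proof.
move=> AB /card_ltNge nCB; apply/card_ltNge => CA.
exact: nCB (card_le_trans CA AB).
Qed.

Lemma card_lt_succ_card (T U : Type) (A : set T) (B : set U) :
  A #< succ_card B <-> A #<= B.
Proof.
have [ltBS minS] := succ_cardP B; split=> [/card_ltNge nSA|AB].
  apply: contrapT => /card_ltNge BA; exact: nSA (minS _ _ BA).
exact: card_le_lt_trans AB ltBS.
Qed.

Lemma card_le_exists_subset (T U : Type) (A : set T) (B : set U) :
  A #<= B -> exists2 C, C `<=` B & C #= A.
Proof.
elim/Ppointed: U => U in B *.
  by rewrite card_le_emptyr => /eqP ->; exists set0; rewrite ?card_eq00.
move=> /pcard_leP[f]; exists (f @` A); last exact: card_image.
by move=> _ [a Aa <-]; exact: (@funS _ _ _ _ f).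
Qed.

Lemma image_inj_subset (T U : Type) (x A B : set T) (f : T -> U) :
  set_inj x f -> A `<=` x -> B `<=` x -> f @` A = f @` B -> A = B.
Proof.
move=> finj.
have sub C D : C `<=` x -> D `<=` x -> f @` C = f @` D -> C `<=` D.
  move=> Cx Dx CD a Ca; have [b Db ba] : (f @` D) (f a) by rewrite -CD; exists a.
  by rewrite -(finj b a) ?inE //; [exact: Dx|exact: Cx].
by move=> Ax Bx AB; apply/seteqP; split; apply: sub.
Qed.

Lemma sub_slim_family (T U : Type) (kappa : set T) (lambda : set U)
    (F G : set (set U)) :
  G `<=` F -> slim_family kappa lambda F -> slim_family kappa lambda G.
Proof.
move=> GF [Fsub Fslim]; split=> [A /GF/Fsub //|x /Fslim].
by apply: card_le_lt_trans; apply: subset_card_le; exact: image_subset.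
Qed.

(** A set [y] smaller than [kappa] pulls back along [f] to a subset [z] of [x]
    that is no larger, and tracing on [y] after applying [f] is the same as
    applying [f] after tracing on [z]. *)
Lemma slim_family_image (T U V : Type) (kappa : set T) (lambda : set U)
    (mu x : set V) (F : set (set V)) (f : V -> U) :
  x `<=` mu -> set_inj x f -> (forall v, x v -> lambda (f v)) ->
  slim_family kappa mu F ->
  slim_family kappa lambda (image^~ f @` family_restr F x).
Proof.
move=> xmu finj flam [_ Fslim]; split.
  by move=> _ [_ [A FA <-] <-] _ [v [_ xv] <-]; exact: flam.
move=> y [_ ltyk]; pose z := x `&` f @^-1` y.
have lezy : z #<= y.
  have /card_eqPle[_ h] : f @` z #= z.
    by apply: inj_card_eq; apply: sub_in2 finj => v; rewrite !inE => -[].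
  by apply: card_le_trans h _; apply: subset_card_le => _ [v [_ yv] <-].
have /Fslim ltFz : Pkappa kappa mu z.
  by split; [move=> v [/xmu]|exact: card_le_lt_trans lezy ltyk].
apply: card_le_lt_trans ltFz.
apply: card_le_trans (card_image_le (image^~ f) _).
apply: subset_card_le => _ [_ [_ [A FA <-] <-] <-].
exists (A `&` z); first by exists A.
apply/seteqP; split=> [_ [v [Av [xv yv]] <-]|_ [[v [Av xv] <-] yv]].
  by split=> //; exists v.
by exists v.
Qed.

Lemma KH3_of_trace (T U V W : Type) (kappa : set T) (lambda : set U)
    (mu x : set V) (F : set (set V)) (nu : set W) :
  lambda !=set0 -> slim_family kappa mu F -> x `<=` mu -> x #<= lambda ->
  nu #<= family_restr F x -> KH3 kappa lambda nu.
Proof.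
move=> lam0 Fslim xmu xlam nuF.
have [f finj flam] : exists2 f : V -> U,
    set_inj x f & forall v, x v -> lambda (f v).
  (* [f] is total on [V], so outside [x] it needs a default value in [U], which
     is where [lambda !=set0] enters. *)
  elim/Ppointed: U => U in lambda lam0 xlam *; first by have [u _] := lam0; have := no u.
  move: xlam => /pcard_leP[f]; exists f; first exact: inj.
  by move=> v xv; exact: (@funS _ _ _ _ f).
have restrE : image^~ f @` family_restr F x #= family_restr F x.
  apply: inj_card_eq => A B /set_mem[A' _ <-] /set_mem[B' _ <-].
  by apply: (image_inj_subset finj) => v [].
have [G GF Gnu] : exists2 G, G `<=` image^~ f @` family_restr F x & G #= nu.
  by apply: card_le_exists_subset; rewrite (card_le_eqr restrE).
exists G; split=> //; apply: sub_slim_family GF _.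
exact: slim_family_image xmu finj flam Fslim.
Qed.

Theorem lemma3p4 (T U V : Type)
    (kappa : set T) (lambda : set U) (mu : set V)
    (kappa_inf : infinite_set kappa) (lambda_inf : infinite_set lambda)
    (mu_inf : infinite_set mu)
    (kappa_le_lambda : kappa #<= lambda) (lambda_lt_mu : lambda #< mu) :
  ~ KH kappa lambda -> KH kappa mu -> KH (succ_card lambda) mu.
Proof.
move=> nKH [F [Fslim Fcard]]; exists F; split=> //.
split=> [|x [xmu /card_lt_succ_card xlam]]; first exact: Fslim.1.
apply/card_ltNge => leSF; apply: nKH.
exact: KH3_of_trace (infinite_setN0 lambda_inf) Fslim xmu xlam leSF.
Qed.
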